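(* Let $G$ be a graph, let $f:G\to G$ be a vertex map and let $L_f:G\to G$ be its linearization. Let $\mathrm{Per}(L_f)$ denote the set of minimal periods of periodic points of $L_f$. Then there exist integers $r,s\ge 0$, positive integers $p_1,\dots,p_r$ and $q_1,\dots,q_s$, and sets $K_1,\dots,K_s$ of positive integers, each containing all but finitely many positive integers, such that $$\mathrm{Per}(L_f)=\left(\bigcup_{i=1}^{s}\{kq_i : k\in K_i\}\right)\cup\{p_1,\dots,p_r\}.$$ Moreover, if the spectral radius of the Markov matrix $M(L_f)$ is $1$, then $\mathrm{Per}(L_f)=\{p_1,\dots,p_r\}$ for some positive integers $p_1,\dots,p_r$ (i.e. $s$ can be taken to be $0$).
   Context: Graph: a connected space $G$ that is a union of finitely many vertices and finitely many edges $E_1,\dots,E_e$. Each edge is homeomorphic to $[0,1]$, its two boundary points are distinct vertices (no loops), no vertex is an interior point of an edge, and two distinct edges intersect in the empty set, one vertex or two vertices (so several edges may join the same two vertices). Each edge is given unit length via a fixed homeomorphism with $[0,1]$; a path of $m$ edges has length $m$. Vertex map: a continuous map $f:G\to G$ that permutes the vertices of $G$. Linearization: $L_f:G\to G$ agrees with $f$ on vertices, and for each edge $E_i$ with endpoints $V_1,V_2$, $L_f$ maps $E_i$ linearly (i.e. at constant speed with respect to edge length) onto the unique reduced (no backtracking) edge path from $f(V_1)$ to $f(V_2)$ that is homotopic to $f|_{E_i}$ relative to the endpoints of $E_i$. Markov matrix: $M=M(L_f)$ is the $e\times e$ matrix whose entry $M_{i,j}$ is the number of closed subintervals of $E_j$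 that $L_f$ maps homeomorphically onto $E_i$ (equivalently, the number of times the edge path $L_f(E_j)$ traverses $E_i$). *)

(* Defs.v *)
From HB Require Import structures.
From mathcomp Require Export all_boot all_order all_algebra.
From mathcomp Require Export finmap.
From mathcomp Require Export all_classical all_reals all_analysis.
From mathcomp Require Export complex.
Export Order.TTheory GRing.Theory Num.Theory.
Export numFieldNormedType.Exports.

Set Implicit Arguments.
Unset Strict Implicit.
Unset Printing Implicit Defensive.

Local Open Scope classical_set_scope.
Local Open Scope ring_scope.

(* Only the values of [f] on [A], and of the inverse on [B], are relevant. *)
Definition homeomorphism_on (X Y : topologicalType) (A : set X) (B : set Y)
    (f : X -> Y) : Prop :=
  exists g : Y -> X,
    [/\ {within A, continuous f}, {within B, continuous g},
        (forall x, A x -> B (f x) /\ g (f x) = x) &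
        (forall y, B y -> A (g y) /\ f (g y) = y)].

Definition unit_interval (R : realType) : set R := `[0, 1]%classic.

(* [edge i], restricted to [0, 1], is the fixed homeomorphism that gives the
   i-th edge unit length; its values outside [0, 1] play no role. *)
Record graph (R : realType) := Graph {
  space :> topologicalType;
  vertices : set space;
  edge_count : nat;
  edge : 'I_edge_count -> R -> space;
  space_hausdorff : hausdorff_space space;
  space_connected : connected [set: space];
  vertices_finite : finite_set vertices;
  space_cover :
    [set: space] =
      vertices `|` \bigcup_(i in setT) (edge i @` @unit_interval R);
  edge_homeomorphism : forall i,
    homeomorphism_on (@unit_interval R) (edge i @` @unit_interval R) (edge i);
  edge_boundary : forall i,
    [/\ vertices (edge i 0), vertices (edge i 1) & edge i 0 <> edge i 1];
  edge_interior : forall i (t : R), 0 < t < 1 -> ~ vertices (edge i t);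
  edge_intersection : forall i j, i <> j ->
    let I := (edge i @` @unit_interval R) `&` (edge j @` @unit_interval R) in
    [\/ I = set0,
        exists2 v, vertices v & I = [set v] |
        exists v w, [/\ vertices v, vertices w, v <> w & I = [set v; w]]]
}.

Arguments vertices {R} g _.

Section GraphMaps.
Context {R : realType} (G : graph R).

Definition edge_set (i : 'I_(edge_count G)) : set G :=
  edge i @` @unit_interval R.

Definition vertex_map (f : G -> G) : Prop :=
  continuous f /\ set_bij (vertices G) (vertices G) f.

(* [(i, true)] is the i-th edge run from [edge i 0] to [edge i 1], and
   [(i, false)] is the same edge run backwards. *)
Definition oriented_edge : Type := 'I_(edge_count G) * bool.

Definition oedge (o : oriented_edge) (t : R) : G :=
  edge o.1 (if o.2 then t else 1 - t).

Fixpoint edge_path (x : G) (p : seq oriented_edge) (y : G) : Prop :=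
  if p is o :: p' then oedge o 0 = x /\ edge_path (oedge o 1) p' y else x = y.

Definition reduced (p : seq oriented_edge) : bool :=
  sorted (fun o o' => o' != (o.1, ~~ o.2)) p.

(* [c], on [0, 1], runs through the path [p], whose length is its number m of
   edges, at constant speed m: the k-th edge is covered on [k/m, (k+1)/m]. *)
Definition linear_along (c : R -> G) (p : seq oriented_edge) : Prop :=
  forall (k : nat) (o : oriented_edge) (t : R),
    onth p k = Some o -> 0 <= t <= 1 ->
    c ((k%:R + t) / (size p)%:R) = oedge o t.

Definition homotopic_rel_endpoints (T : topologicalType) (c d : R -> T) :
    Prop :=
  exists H : R * R -> T,
    [/\ {within @unit_interval R `*` @unit_interval R, continuous H},
        (forall t, 0 <= t <= 1 -> H (0, t) = c t),
        (forall t, 0 <= t <= 1 -> H (1, t) = d t),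
        (forall s, 0 <= s <= 1 -> H (s, 0) = c 0) &
        (forall s, 0 <= s <= 1 -> H (s, 1) = c 1)].

(* These conditions determine [L] on all of [G].  As [f] is injective on the
   vertices, the path [p] below cannot be empty. *)
Definition is_linearization (f L : G -> G) : Prop :=
  (forall v, vertices G v -> L v = f v) /\
  forall i : 'I_(edge_count G), exists p : seq oriented_edge,
    [/\ edge_path (f (edge i 0)) p (f (edge i 1)), reduced p,
        linear_along (L \o edge i) p &
        homotopic_rel_endpoints (f \o edge i) (L \o edge i)].

(* The closed subintervals of the j-th edge are encoded by the pairs of their
   endpoints a < b in [0, 1]. *)
Definition covering_subintervals (L : G -> G) (i j : 'I_(edge_count G)) :
    set (R * R) :=
  [set ab | [/\ 0 <= ab.1, ab.1 < ab.2, ab.2 <= 1 &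
     homeomorphism_on (`[ab.1, ab.2]%classic : set R) (edge_set i) (L \o edge j)]].

(* For a linearization the sets counted here are finite; [fset_set] would
   return the empty set on an infinite one. *)
Definition markov_matrix (L : G -> G) : 'M[nat]_(edge_count G) :=
  \matrix_(i, j) #|` fset_set (covering_subintervals L i j)|%N.

End GraphMaps.

(* The supremum is a maximum, except for n = 0 where it is 0. *)
Definition spectral_radius (R : realType) (n : nat) (A : 'M[R[i]]_n) : R :=
  sup [set complex.Re `|a| | a in [set a : R[i] | eigenvalue A a]].

Definition minimal_period (T : Type) (f : T -> T) (x : T) (n : nat) : Prop :=
  [/\ (0 < n)%N, iter n f x = x &
      forall k : nat, (0 < k < n)%N -> iter k f x <> x].

Definition periods (T : Type) (f : T -> T) : set nat :=
  [set n | exists x, minimal_period f x n].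

(* Main.v *)
(* A periodic point that is not a vertex never meets a vertex, so on such points
   L lifts to a piecewise affine Markov map F of pairs (edge, parameter), whose
   itineraries are walks in the Markov graph.  Conversely every closed walk is
   followed by a fixed point of the corresponding affine inverse branch.

   Fix an edge j and let q generate the group spanned by the lengths of the
   closed walks at j.  If two different closed walks u, v at j have the same
   length, then the walks u^k v c, with c closed of suitable bounded length,
   realise all large multiples of q as exact periods.  Otherwise the walk of a
   periodic point is determined by its length, and iterating twice any closed
   walk u gives an increasing affine map, whose periodic points are fixed, so
   that all periods at j are at most 2 |u|.

   In the first case the (j, j) entry of a power of M is at least 2; the traces
   of its powers then grow exponentially, and the spectral radius exceeds 1. *)

Require Import Defs.
From mathcomp Require Import zify ring lra spectral.

Set Implicit Arguments.
Unset Strict Implicit.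
Unset Printing Implicit Defensive.

Local Open Scope classical_set_scope.
Local Open Scope ring_scope.

(** * Minimal periods and additive semigroups of integers *)

Lemma minimal_period_iter_inj (T : Type) (f : T -> T) (x : T) (n a b : nat) :
  minimal_period f x n -> (a < n)%N -> (b < n)%N ->
  iter a f x = iter b f x -> a = b.
Proof.
move=> [n0 fn min_n].
wlog ab : a b / (a < b)%N.
  move=> hw an bn fab; case: (ltngtP a b) => // h; first exact: hw.
  by apply/esym/hw.
move=> an bn fab; case: (min_n (n - b + a)%N); first lia.
by rewrite iterD fab -iterD subnK// ltnW.
Qed.

(** [q] is the least positive difference of two elements [b] and [b + q] of [A]. It divides every
    element, and combinations of [b] and [b + q] reach all large multiples of [q]. *)
Lemma semigroup_eventual_multiples (A : set nat) (N : nat) :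
  A 0%N -> (forall a b, A a -> A b -> A (a + b)%N) -> A N -> (0 < N)%N ->
  exists q B, [/\ (0 < q)%N, (forall n, A n -> (q %| n)%N) &
    forall n, (q %| n)%N -> (B <= n)%N -> A n].
Proof.
move=> A0 AD AN N0.
have AM k a : A a -> A (k * a)%N.
  by move=> Aa; elim: k => // k IH; rewrite mulSn; apply: AD.
pose D d := (0 < d)%N /\ exists2 b, A b & A (b + d)%N.
have ex : exists d, `[< D d >].
  by exists N; apply/asboolP; split => //; exists 0%N.
case: (ex_minnP ex) => q /asboolP[q0 [b Ab Abq]] min_q.
have dvdA n : A n -> (q %| n)%N.
  move=> An; rewrite /dvdn eqn0Ngt; apply/negP => r0.
  have : (q <= n %% q)%N.
    apply/min_q/asboolP; split => //.
    (* The element [n + n %/ q * b] exceeds this one by [n %% q], so a nonzero remainder would be a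
       smaller difference. *)
    exists (n %/ q * (b + q))%N; first exact: AM.
    have -> : (n %/ q * (b + q) + n %% q = n + n %/ q * b)%N.
      by rewrite {3}(divn_eq n q); lia.
    by apply: AD => //; apply: AM.
  by rewrite leqNgt ltn_pmod.
have /dvdnP[be b_eq] := dvdA _ Ab.
(* For [be > 0], write [n = h * q] and [h = c * be + r] with [r < be]. The bound gives [be <= c],
   and then [n = (c - r) * b + r * (b + q)]. *)
exists q, (q * be ^ 2)%N; split => // n /dvdnP[h n_eq] nB.
have hB : (be ^ 2 <= h)%N by move: nB; rewrite n_eq mulnC leq_pmul2r.
have [be0|be0] := posnP be.
  by rewrite n_eq; apply: AM; move: Abq; rewrite b_eq be0.
have h_eq := divn_eq h be.
have rb := ltn_pmod h be0.
have cb : (be <= h %/ be)%N by rewrite leq_divRL// mulnn.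
have -> : (n = (h %/ be - h %% be) * b + h %% be * (b + q))%N.
  rewrite n_eq {1}h_eq b_eq mulnDr addnA -mulnDl subnK; last lia.
  by rewrite mulnDl mulnA.
by apply: AD; apply: AM.
Qed.

Lemma iter_period (T : Type) (f : T -> T) (x : T) (n k : nat) :
  iter n f x = x -> iter (k * n) f x = x.
Proof. by move=> fx; elim: k => // k IH; rewrite mulSn iterD IH. Qed.

Lemma minimal_period_dvdn (T : Type) (f : T -> T) (x : T) (d n : nat) :
  minimal_period f x d -> iter n f x = x -> (d %| n)%N.
Proof.
move=> [d0 fd min_d] fn.
have := divn_eq n d => n_eq.
have fr : iter (n %% d) f x = x.
  by rewrite -[RHS]fn {2}n_eq addnC iterD iter_period.
rewrite /dvdn eqn0Ngt; apply/negP => r0.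
by apply: (min_d (n %% d)%N); rewrite ?r0 ?ltn_pmod.
Qed.

Lemma minimal_period_exists (T : Type) (f : T -> T) (x : T) (n : nat) :
  (0 < n)%N -> iter n f x = x -> exists d, minimal_period f x d.
Proof.
move=> n0 fn.
have ex : exists m, (0 < m)%N && `[< iter m f x = x >].
  by exists n; rewrite n0; apply/asboolP.
case: (ex_minnP ex) => d /andP[d0 /asboolP fd] min_d.
exists d; split => // k /andP[k0 kd] fk.
have := min_d k; rewrite k0 /= => /(_ (asboolT fk)).
by rewrite leqNgt kd.
Qed.

(** * The lift to pairs (edge, parameter): walks, itineraries, inverse branches *)

Section MarkovDynamics.
Context {R : realType} {e : nat} (P : 'I_e -> seq ('I_e * bool)).
Context (P_gt0 : forall j, (0 < size (P j))%N).
Implicit Types (j : 'I_e) (k : nat) (ks u v w : seq nat) (t : R).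

Definition target j k : 'I_e * bool := nth (j, true) (P j) k.

Definition flip (b : bool) t : R := if b then t else 1 - t.

Lemma flipK b : involutive (flip b).
Proof. by case: b => t /=; lra. Qed.

Lemma flip_itvcc b t : 0 <= t <= 1 -> 0 <= flip b t <= 1.
Proof. by case: b => /=; lra. Qed.

Lemma flip_itvoo b t : 0 < t < 1 -> 0 < flip b t < 1.
Proof. by case: b => /=; lra. Qed.

(** A walk is coded by positions in the successive edge paths rather than by the edges visited, so
    that two passages of [P j] over one edge give different walks. *)
Fixpoint walk j ks i : bool :=
  if ks is k :: ks' then (k < size (P j))%N && walk (target j k).1 ks' i
  else j == i.

(** The inverse branch along [ks]: [t] is a parameter on the last edge of the walk, the value a
    parameter on [j]. *)
Fixpoint branch j ks t : R :=
  if ks is k :: ks' then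
    (k%:R + flip (target j k).2 (branch (target j k).1 ks' t)) / (size (P j))%:R
  else t.

(* At a point interior to the edge but sent to a vertex the right-hand piece is
   chosen; at the end [1] only the last piece is available. *)
Definition piece (z : 'I_e * R) : nat :=
  minn (Num.truncn ((size (P z.1))%:R * z.2)) (size (P z.1)).-1.

Definition lifted_map (z : 'I_e * R) : 'I_e * R :=
  ((target z.1 (piece z)).1,
   flip (target z.1 (piece z)).2 ((size (P z.1))%:R * z.2 - (piece z)%:R)).

Definition itinerary (z : 'I_e * R) (n : nat) : seq nat :=
  [seq piece (iter i lifted_map z) | i <- iota 0 n].

Lemma size_itinerary z n : size (itinerary z n) = n.
Proof. by rewrite size_map size_iota. Qed.

Lemma itineraryS z n :
  itinerary z n.+1 = piece z :: itinerary (lifted_map z) n.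
Proof.
rewrite /itinerary /= -[1%N]addn0 iotaDl -map_comp; congr (_ :: _).
by apply: eq_map => i /=; rewrite -iterSr.
Qed.

Lemma itineraryD z m n :
  itinerary z (m + n) = itinerary z m ++ itinerary (iter m lifted_map z) n.
Proof.
elim: m z => // m IH z.
by rewrite addSn !itineraryS IH /= -iterSr.
Qed.

Lemma nth_itinerary z n i :
  (i < n)%N -> nth 0%N (itinerary z n) i = piece (iter i lifted_map z).
Proof. by move=> ni; rewrite (nth_map 0%N) ?size_iota// nth_iota. Qed.

Lemma size_gt0 j : 0 < (size (P j))%:R :> R.
Proof. by rewrite ltr0n. Qed.

Lemma piece_lt z : (piece z < size (P z.1))%N.
Proof. by rewrite /piece; have := P_gt0 z.1; lia. Qed.

Lemma piece_itv z : 0 <= z.2 <= 1 ->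
  0 <= (size (P z.1))%:R * z.2 - (piece z)%:R <= 1.
Proof.
move=> /andP[t0 t1]; have m0 := size_gt0 z.1.
rewrite /piece; set m := size _ in m0 *; set s := m%:R * z.2.
have s0 : 0 <= s by rewrite mulr_ge0// ltW.
have sm : s <= m%:R by rewrite ler_piMr// ltW.
have /andP[tr1 tr2] := truncn_itv s0.
case: (leqP (Num.truncn s) m.-1) => h.
  by apply/andP; split; [lra | move: tr2; rewrite -natr1; lra].
have -> : m.-1%:R = m%:R - 1 :> R.
  by have := @natr1 R m.-1; rewrite (@prednK m) ?P_gt0//; lra.
have : m%:R <= s.
  by apply: le_trans tr1; rewrite ler_nat; move: h; rewrite /m; lia.
by lra.
Qed.

Lemma lifted_map_itv z : 0 <= z.2 <= 1 -> 0 <= (lifted_map z).2 <= 1.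
Proof. by move=> /piece_itv; apply: flip_itvcc. Qed.

Lemma iter_lifted_map_itv z n :
  0 <= z.2 <= 1 -> 0 <= (iter n lifted_map z).2 <= 1.
Proof. by move=> z01; elim: n => // n /lifted_map_itv; rewrite -iterS. Qed.

Lemma walk_itinerary z n :
  walk z.1 (itinerary z n) (iter n lifted_map z).1.
Proof.
elim: n z => [|n IH] z; first exact: eqxx.
by rewrite iterSr itineraryS /= piece_lt; exact: (IH (lifted_map z)).
Qed.

Lemma branch_itinerary z n :
  branch z.1 (itinerary z n) (iter n lifted_map z).2 = z.2.
Proof.
elim: n z => // n IH z.
rewrite iterSr itineraryS /=.
rewrite [branch _ _ _](IH (lifted_map z)) /lifted_map /= flipK.
by have m0 := size_gt0 z.1; field; lra.
Qed.

Lemma walk_cat j u v i l : walk j u i -> walk j (u ++ v) l = walk i v l.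
Proof.
by elim: u j => [|k u IH] j /=; [move/eqP-> | case/andP=> -> /IH].
Qed.

Lemma walk_end j u i l : walk j u i -> walk j u l -> i = l.
Proof.
elim: u j => [|k u IH] j /=; first by move=> /eqP<- /eqP.
by case/andP=> _ + /andP[_]; exact: IH.
Qed.

Definition pow_word u n : seq nat := iter n (cat u) [::].

Lemma size_pow_word u n : size (pow_word u n) = (n * size u)%N.
Proof. by elim: n => // n IH; rewrite /= size_cat IH mulSn. Qed.

Lemma walk_pow j u n : walk j u j -> walk j (pow_word u n) j.
Proof. by move=> wu; elim: n => //= n IH; rewrite (walk_cat _ _ wu). Qed.

Lemma branch_affine j ks :
  exists A B, B != 0 /\ forall t, branch j ks t = A + B * t.
Proof.
elim: ks j => [|k ks IH] j /=.
  by exists 0, 1; split; [exact: oner_neq0 | move=> t; lra].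
have [A [B [B0 AB]]] := IH (target j k).1.
have m0 := size_gt0 j; have m1 : (size (P j))%:R != 0 :> R by lra.
case: (target j k).2 => /=.
  exists ((k%:R + A) / (size (P j))%:R), (B / (size (P j))%:R); split.
    by rewrite mulf_neq0// invr_neq0.
  by move=> t; rewrite AB; field.
exists ((k%:R + 1 - A) / (size (P j))%:R), (- B / (size (P j))%:R); split.
  by rewrite mulf_neq0 ?invr_neq0// oppr_eq0.
by move=> t; rewrite AB; field.
Qed.

Lemma piece_bound j k t : (k < size (P j))%N -> 0 <= t <= 1 ->
  0 <= (k%:R + t) / (size (P j))%:R <= 1.
Proof.
move=> km t01; have m0 := size_gt0 j.
have k0 : 0 <= k%:R :> R by [].
have : k.+1%:R <= (size (P j))%:R :> R by rewrite ler_nat.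
rewrite -natr1 => km'.
by rewrite divr_ge0 ?ler_pdivrMr//=; lra.
Qed.

Lemma piece_bound_oo j k t : (k < size (P j))%N -> 0 < t < 1 ->
  0 < (k%:R + t) / (size (P j))%:R < 1.
Proof.
move=> km t01; have m0 := size_gt0 j.
have k0 : 0 <= k%:R :> R by [].
have : k.+1%:R <= (size (P j))%:R :> R by rewrite ler_nat.
rewrite -natr1 => km'.
by rewrite divr_gt0 ?ltr_pdivrMr//=; lra.
Qed.

Lemma branch_itvcc j ks i t :
  walk j ks i -> 0 <= t <= 1 -> 0 <= branch j ks t <= 1.
Proof.
move=> + t01; elim: ks j => //= k ks IH j /andP[km /IH h].
by apply: piece_bound => //; apply: flip_itvcc.
Qed.

Lemma branch_itvoo j ks i t :
  walk j ks i -> 0 < t < 1 -> 0 < branch j ks t < 1.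
Proof.
move=> + t01; elim: ks j => //= k ks IH j /andP[km /IH h].
by apply: piece_bound_oo => //; apply: flip_itvoo.
Qed.

Lemma branch_loop_fixpoint j ks :
  walk j ks j -> exists2 t, 0 <= t <= 1 & branch j ks t = t.
Proof.
move=> wj; have [A [B [B0 AB]]] := branch_affine j ks.
have := @branch_itvcc _ _ _ 0 wj; have := @branch_itvcc _ _ _ 1 wj.
rewrite !AB mulr0 mulr1 addr0 !lexx ler01 => /(_ isT) h1 /(_ isT) h0.
(* An affine self-map of [0, 1] of slope 1 is the identity; any other has slope less than 1 and
   fixes [A / (1 - B)]. *)
have [B1|B1] := eqVneq B 1.
  by exists 0; [lra | rewrite AB; lra].
have {}B1 : B < 1 by rewrite lt_neqAle B1; lra.
exists (A / (1 - B)); last by rewrite AB; field; lra.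
by rewrite divr_ge0 ?ler_pdivrMr//=; lra.
Qed.

Definition end_point t := t = 0 \/ t = 1.

(** The disjunction excludes the one ambiguous case, the right end of a piece other than the last,
    which [piece] attributes to the next piece. *)
Lemma lifted_map_piece j k t : (k < size (P j))%N -> 0 <= t <= 1 ->
  let y := (k%:R + flip (target j k).2 t) / (size (P j))%:R in
  0 < t < 1 \/ end_point y ->
  piece (j, y) = k /\ lifted_map (j, y) = ((target j k).1, t).
Proof.
move=> km t01 y hy; have m0 := size_gt0 j.
have my : (size (P j))%:R * y = k%:R + flip (target j k).2 t.
  by rewrite /y; field; lra.
have k0 : 0 <= k%:R :> R by [].
have := km; rewrite -(ler_nat R) -natr1 => km'.
have x01 := flip_itvcc (target j k).2 t01.
suff pk : piece (j, y) = k.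
  split => //; rewrite /lifted_map pk /= my addrC addKr.
  by rewrite flipK.
have x_lt1_piece : flip (target j k).2 t < 1 -> piece (j, y) = k.
  move=> x1; rewrite /piece /= my.
  rewrite (@truncn_def _ _ k); last by rewrite -natr1; lra.
  by apply/minn_idPl; rewrite -ltnS (ltn_predK km).
have [x1|x1] := ltP (flip (target j k).2 t) 1; first exact: x_lt1_piece.
have {x1 x_lt1_piece}x1 : flip (target j k).2 t = 1 by lra.
case: hy => [t01'|[y0|y1]].
- by have := flip_itvoo (target j k).2 t01'; rewrite x1 ltxx andbF.
- by exfalso; move: my; rewrite y0 x1; lra.
- move: my; rewrite y1 x1 mulr1 natr1 => /eqP; rewrite eqr_nat => /eqP mk.
  by rewrite /piece /= mulr1 natrK mk /=; apply/minn_idPr.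
Qed.

Lemma end_point_branch j k ks i t :
  walk j (k :: ks) i -> 0 <= t <= 1 -> end_point (branch j (k :: ks) t) ->
  end_point (branch (target j k).1 ks t).
Proof.
move=> wj t01 h.
have /andP[km wk] := wj.
have b01 := branch_itvcc wk t01.
have [b0|b0] := eqVneq (branch (target j k).1 ks t) 0; first by left.
have [b1|b1] := eqVneq (branch (target j k).1 ks t) 1; first by right.
have b01' : 0 < branch (target j k).1 ks t < 1 by rewrite !lt_neqAle eq_sym b0 b1.
have /= := piece_bound_oo km (flip_itvoo (target j k).2 b01').
by move: h => [] /= ->; rewrite ltxx ?andbF.
Qed.

(** The disjunction passes to the tail of the walk: an interior [t] stays interior under every
    branch, and since branches preserve the open interval, an end-point value can only come from an
    end point. *)
Lemma itinerary_branch j ks i t :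
  walk j ks i -> 0 <= t <= 1 ->
  0 < t < 1 \/ end_point (branch j ks t) ->
  itinerary (j, branch j ks t) (size ks) = ks /\
  iter (size ks) lifted_map (j, branch j ks t) = (i, t).
Proof.
elim: ks j => [|k ks IH] j; first by move=> /= /eqP ->.
move=> wj t01 h; have /andP[km wk] := wj.
have h' : 0 < t < 1 \/ end_point (branch (target j k).1 ks t).
  by case: h; [left | right; exact: end_point_branch wj t01 _].
have h2 : 0 < branch (target j k).1 ks t < 1 \/ end_point (branch j (k :: ks) t).
  by case: h => ?; [left; exact: branch_itvoo wk _ | right].
have [pk lk] : piece (j, branch j (k :: ks) t) = k /\
    lifted_map (j, branch j (k :: ks) t) =
      ((target j k).1, branch (target j k).1 ks t).
  exact: lifted_map_piece km (branch_itvcc wk t01) h2.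
have [IH1 IH2] := IH _ wk t01 h'.
by rewrite [size _]/= iterSr itineraryS pk lk IH1.
Qed.

Lemma loop_periodic_point j w : walk j w j ->
  exists t, [/\ 0 <= t <= 1, iter (size w) lifted_map (j, t) = (j, t) &
    itinerary (j, t) (size w) = w].
Proof.
move=> wj; have [t t01 bt] := branch_loop_fixpoint wj.
(* As [t] is fixed by the branch, it is either interior or itself an end-point value, so no loop is
   lost. *)
have h : 0 < t < 1 \/ end_point (branch j w t).
  rewrite bt; have [t0|t0] := eqVneq t 0; first by right; left.
  have [t1|t1] := eqVneq t 1; first by right; right.
  by left; rewrite !lt_neqAle eq_sym t0 t1.
by exists t; have := itinerary_branch wj t01 h; rewrite bt => -[].
Qed.

Lemma nth_pow_word u n a :
  (a < n * size u)%N -> nth 0%N (pow_word u n) a = nth 0%N u (a %% size u).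
Proof.
elim: n a => // n IH a; rewrite mulSn /= nth_cat => an.
have [au|au] := ltnP a (size u); first by rewrite modn_small.
by rewrite IH ?ltn_subLR// -{2}(subnK au) modnDr.
Qed.

(* A period [d < n] is at most [n / 2], so that the initial block of powers of
   [u] forces the itinerary to be [size u]-periodic, and [v] to equal [u]. *)
Lemma marked_loop_minimal_period j u v c k :
  walk j u j -> walk j v j -> walk j c j -> u <> v -> size u = size v ->
  (k * size u + size u + size c <= 2 * (k.-1 * size u))%N ->
  exists2 t, 0 <= t <= 1 &
    minimal_period lifted_map (j, t) (k * size u + size u + size c).
Proof.
move=> wu wv wc uv uv_size; set n := (_ + _ + _)%N => n_le.
set N := size u in n n_le *.
pose w := pow_word u k ++ v ++ c.
have ww : walk j w j.
  by rewrite (walk_cat _ _ (walk_pow _ wu)) (walk_cat _ _ wv).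
have wn : size w = n by rewrite !size_cat size_pow_word -uv_size addnA.
have [t [t01]] := loop_periodic_point ww; rewrite wn => Fn it_w.
exists t => //; set z := (j, t) in Fn it_w *.
have N0 : (0 < N)%N.
  rewrite lt0n; apply/eqP => u0; apply: uv.
  by rewrite (size0nil u0); apply/esym/size0nil; rewrite -uv_size.
have n0 : (0 < n)%N by rewrite /n; lia.
have k0 : (0 < k)%N.
  by rewrite lt0n; apply/eqP => k_0; move: n_le n0; rewrite k_0; lia.
have kN : (k * N = k.-1 * N + N)%N by rewrite -{1}(prednK k0) mulSn addnC.
have [d dP] := minimal_period_exists n0 Fn.
have dn := minimal_period_dvdn dP Fn.
case: (ltngtP d n) => [d_lt|d_gt|<- //]; last by have := dvdn_leq n0 dn; lia.
have d2 : (2 * d <= n)%N.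
  by case/dvdnP: dn d_lt => -[|[|m]] ->; lia.
case: dP => d0 Fd _; exfalso; apply: uv.
pose s a := piece (iter a lifted_map z).
have s_w a : (a < n)%N -> s a = nth 0%N w a.
  by move=> an; rewrite -it_w nth_itinerary.
have s_mod a b : s (a %% d + b)%N = s (a + b)%N.
  have -> : (a + b = (a %% d + b) + a %/ d * d)%N by rewrite {1}(divn_eq a d); lia.
  by rewrite /s [in RHS]iterD iter_period.
have s_u a : (a < k * N)%N -> s a = nth 0%N u (a %% N).
  move=> ak; rewrite s_w; last by rewrite /n; lia.
  by rewrite nth_cat size_pow_word -/N ak nth_pow_word.
(* Since [2 * d <= n <= 2 * (k.-1 * N)], reducing [a] modulo [d] brings both [a] and [a + N] into
   the initial powers of [u]. *)
have s_N a : s (a + N)%N = s a.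
  have ad : (a %% d < k.-1 * N)%N by have := ltn_pmod a d0; lia.
  rewrite -s_mod -[RHS](congr1 s (addn0 a)) -[in RHS]s_mod addn0.
  by rewrite !s_u ?modnDr//; lia.
have s_kN a m : s (a + m * N)%N = s a.
  elim: m => [|m IH]; first by rewrite addn0.
  by rewrite mulSn addnCA addnC s_N.
(* Position [a] lies in the first copy of [u], position [a + k * N] in [v]. *)
apply: (@eq_from_nth _ 0%N) => // a aN.
rewrite -[in LHS](modn_small aN) -s_u; last first.
  by apply: leq_trans aN _; rewrite -/N; nia.
rewrite -(s_kN a k) s_w; last by rewrite /n; lia.
by rewrite nth_cat size_pow_word -/N ltnNge leq_addl /= addnK nth_cat -uv_size aN.
Qed.

Lemma end_point_lifted_map z : end_point z.2 -> end_point (lifted_map z).2.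
Proof.
have fl b t : end_point t -> end_point (flip b t).
  by case: b => // -[] -> /=; rewrite ?subr0 ?subrr; [right|left].
rewrite /lifted_map /piece => -[] -> /=; apply: fl.
  by rewrite mulr0 truncn0 min0n subrr; left.
rewrite mulr1 natrK (minn_idPr (leq_pred _)); right.
have := @natr1 R (size (P z.1)).-1; rewrite prednK// => <-.
by lra.
Qed.

(** End points are sent to end points, and there are only [2 * e] pairs of an edge and an end point,
    so a periodic orbit among them has period at most [2 * e]. *)
Lemma minimal_period_interior z n :
  (2 * e < n)%N -> 0 <= z.2 <= 1 -> minimal_period lifted_map z n ->
  0 < z.2 < 1.
Proof.
move=> en z01 zn.
suff : ~ end_point z.2.
  move=> h; rewrite !lt_neqAle; case/andP: z01 => -> ->.
  by rewrite !andbT; apply/andP; split; apply/eqP => h'; apply: h; [left|right].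
move=> zE; have zE' a : end_point (iter a lifted_map z).2.
  by elim: a => // a; exact: end_point_lifted_map.
pose g (a : 'I_n) : 'I_e * bool :=
  ((iter a lifted_map z).1, (iter a lifted_map z).2 == 0).
have g_inj : injective g.
  move=> a b [ab1 ab2]; apply/val_inj.
  apply: (minimal_period_iter_inj zn (ltn_ord a) (ltn_ord b)).
  move: ab1 ab2 (zE' a) (zE' b).
  case: (iter a _ _) (iter b _ _) => [? x] [? y] /= -> xy hx hy; congr (_, _).
  by move: xy; case: hx => ->; case: hy => -> //; rewrite eqxx oner_eq0.
have := leq_card g g_inj.
by rewrite card_prod !card_ord card_bool; lia.
Qed.

Lemma distinct_loops_periods j u v :
  walk j u j -> walk j v j -> u <> v -> size u = size v ->
  exists q B, [/\ (0 < q)%N,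
    (forall t n, iter n lifted_map (j, t) = (j, t) -> (q %| n)%N) &
    (forall n, (q %| n)%N -> (B <= n)%N ->
       exists2 t, 0 < t < 1 & minimal_period lifted_map (j, t) n)].
Proof.
move=> wu wv uv uv_size.
have N0 : (0 < size u)%N.
  rewrite lt0n; apply/eqP => u0; apply: uv.
  by rewrite (size0nil u0); apply/esym/size0nil; rewrite -uv_size.
pose A n := exists2 w, walk j w j & size w = n.
have [] := @semigroup_eventual_multiples A (size u) _ _ _ N0.
- by exists [::] => //=.
- move=> _ _ [w ww <-] [w' ww' <-]; exists (w ++ w'); rewrite ?size_cat//.
  by rewrite (walk_cat _ _ ww).
- by exists u.
move=> q [B [q0 qA Aq]].
(* Let [N = size u]. The loop [c] below has length less than [B + N], and [n <= 2 * (k.-1 * N)]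
   amounts to [4 * N + 2 * size c <= n], which [6 * N + 2 * B] ensures. The term [2 * e + 1] makes
   the periodic point interior. *)
exists q, (6 * size u + 2 * B + 2 * e + 1)%N; split => //.
  move=> t n Fn; apply: qA; exists (itinerary (j, t) n).
    by have := walk_itinerary (j, t) n; rewrite Fn.
  by rewrite size_itinerary.
move=> n qn nB; have qN : (q %| size u)%N by apply: qA; exists u.
set N := size u in N0 nB qN.
pose k := ((n - N - B) %/ N)%N.
have k_eq := divn_eq (n - N - B) N; rewrite -/k in k_eq.
have r_lt := ltn_pmod (n - N - B) N0.
have [c wc c_size] : A (n - N - k * N)%N.
  apply: Aq; last lia.
  by rewrite !dvdn_sub// dvdn_mull.
have n_eq : (n = k * N + N + size c)%N by lia.
have k1 : (k.-1 * N = k * N - N)%N by case: (k) => [|k'] /=; lia.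
have [t t01] : exists2 t, 0 <= t <= 1 & minimal_period lifted_map (j, t) n.
  rewrite n_eq; apply: marked_loop_minimal_period wu wv wc uv uv_size _.
  by rewrite -/N k1; lia.
move=> tn; exists t => //.
by apply: (minimal_period_interior _ _ tn) => //; lia.
Qed.

(* [branch j (u ++ u)] is increasing, so its periodic orbits are fixed points. *)
Lemma unique_loops_period j u t n :
  (forall v w, walk j v j -> walk j w j -> size v = size w -> v = w) ->
  walk j u j -> (0 < size u)%N ->
  minimal_period lifted_map (j, t) n -> (n <= 2 * size u)%N.
Proof.
move=> uniq_loop wu u0 tn; have [n0 Fn _] := tn.
set N := size u in u0 *.
(* The itinerary of length [n * N] and the [n]-th power of [u] are closed walks of the same length,
   hence equal. *)
have it_u z : z.1 = j -> iter n lifted_map z = z -> itinerary z N = u.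
  move=> zj Fz.
  have h : itinerary z (n * N) = pow_word u n.
    apply: uniq_loop; last by rewrite size_itinerary size_pow_word.
      by have := walk_itinerary z (n * N); rewrite mulnC iter_period// zj.
    exact: walk_pow.
  case: n n0 {tn Fn Fz} h => // n _; rewrite mulSn itineraryD /=.
  by move/(congr1 (take N)); rewrite !take_size_cat// size_itinerary.
have orb a : (iter (a * N) lifted_map (j, t)).1 = j /\
    iter n lifted_map (iter (a * N) lifted_map (j, t)) =
      iter (a * N) lifted_map (j, t).
  split; last by rewrite -iterD addnC iterD Fn.
  elim: a => // a IH.
  have Fz : iter n lifted_map (iter (a * N) lifted_map (j, t)) =
      iter (a * N) lifted_map (j, t) by rewrite -iterD addnC iterD Fn.
  have := walk_itinerary (iter (a * N) lifted_map (j, t)) N.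
  by rewrite it_u// IH -iterD -mulSn => /walk_end/(_ wu).
pose x a := (iter (a * N) lifted_map (j, t)).2.
have xS a : x a = branch j u (x a.+1).
  rewrite /x; have [xj Fz] := orb a.
  have := branch_itinerary (iter (a * N) lifted_map (j, t)) N.
  by rewrite (it_u _ xj Fz) xj mulSn iterD => ->.
have [A [B [B0 AB]]] := branch_affine j u.
have BB0 : 0 < B * B by rewrite -expr2 exprn_even_gt0//= B0.
(* The branch along [u ++ u] has slope [B * B > 0], so differences over two indices keep their sign
   when the index moves by 2. *)
have xSS a : x a - x a.+2 = (B * B) * (x a.+2 - x a.+4).
  have xS2 b : x b = A + B * (A + B * x b.+2) by rewrite (xS b) (xS b.+1) !AB.
  by rewrite [x a]xS2 [in X in _ - X]xS2; ring.
have xn a : x (a + n)%N = x a.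
  by rewrite /x mulnDl iterD [(n * N)%N]mulnC (iter_period N Fn).
have x02 : x 0%N = x 2%N.
  (* The factor [r] treats both signs at once: a nonzero first difference would make [x (2 * a)]
     strictly monotone in [a], against [x (2 * n) = x 0]. *)
  have mono (r : R) : 0 < r * (x 0%N - x 2%N) -> False.
    move=> r0.
    have dec a : 0 < r * (x (2 * a)%N - x (2 * a.+1)%N).
      elim: a => // a; rewrite [(2 * a.+1)%N]mulnS [(2 * a.+2)%N]mulnS mulnS !add2n.
      by rewrite xSS mulrCA pmulr_rgt0.
    have dec' a : (0 < a)%N -> 0 < r * (x 0%N - x (2 * a)%N).
      elim: a => // -[|a] IH _; first exact: (dec 0%N).
      by have := dec a.+1; have := IH isT; lra.
    have := dec' n n0; rewrite mul2n -addnn xn -[n]add0n xn subrr mulr0.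
    by rewrite ltxx.
  apply/eqP; rewrite -subr_eq0; apply: contrapT => /negP.
  rewrite neq_lt => /orP[h|h].
    by apply: (mono (-1)); rewrite mulN1r oppr_gt0.
  by apply: (mono 1); rewrite mul1r.
have F2 : iter (2 * N) lifted_map (j, t) = (j, t).
  rewrite [LHS]surjective_pairing (orb 2%N).1; congr (_, _).
  by rewrite -[LHS]/(x 2%N) -x02.
by apply: dvdn_leq; [lia | exact: minimal_period_dvdn tn F2].
Qed.

End MarkovDynamics.

(** * Traces of matrix powers and the spectral radius *)

Lemma trigmx_expr (F : comNzRingType) (n : nat) (T : 'M[F]_n) (N : nat) :
  is_trig_mx T -> is_trig_mx (T ^+ N) /\ forall i, (T ^+ N) i i = T i i ^+ N.
Proof.
move=> /is_trig_mxP T0; elim: N => [|N [/is_trig_mxP TN0 TNd]].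
  split=> [|i]; last by rewrite !expr0 !mxE eqxx.
  by apply/is_trig_mxP => i j ij; rewrite expr0 mxE -val_eqE (ltn_eqF ij).
split.
  apply/is_trig_mxP => i j ij; rewrite exprS mxE big1// => k _.
  have [ik|ki] := ltnP i k; first by rewrite T0 ?mul0r.
  by rewrite TN0 ?mulr0//; exact: leq_ltn_trans ki ij.
move=> i; rewrite exprS mxE (bigD1 i)//= big1 ?addr0; last first.
  move=> k ki; case: (ltngtP i k) => [ik|ki'|/val_inj ik].
  - by rewrite T0 ?mul0r.
  - by rewrite TN0 ?mulr0.
  - by rewrite ik eqxx in ki.
by rewrite TNd exprS.
Qed.

(** A Schur triangular form carries eigenvalues of [A] on its diagonal, its [N]-th power carries
    their [N]-th powers, and similarity preserves the trace. *)
Lemma norm_mxtrace_expr_le (C : numClosedFieldType) (n : nat) (A : 'M[C]_n)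
    (N : nat) :
  (forall a, eigenvalue A a -> `|a| <= 1) -> `|\tr (A ^+ N)| <= n%:R.
Proof.
move=> A1; have [n0|n0] := posnP n.
  by move: A A1; rewrite n0 => A _; rewrite /mxtrace big_ord0 normr0.
have [P /unitarymx_unit Pu PA] := Schur A n0.
pose T := conjmx P A; have T_trig : is_trig_mx T := PA.
have T_eq : T = P *m A *m invmx P by rewrite /T conjumx.
have Teig i : `|T i i| <= 1.
  apply: A1; apply: (@eigenvalue_conjmx _ _ _ P).
  - by rewrite stablemx_unit.
  - by rewrite row_free_unit.
  rewrite [_ \in _]eigenvalue_root_char (char_poly_trig T_trig).
  by rewrite /root horner_prod (bigD1 i)//= hornerXsubC subrr mul0r.
have AN : T ^+ N = P *m A ^+ N *m invmx P.
  elim: N => [|N IH]; first by rewrite !expr0 mulmx1 mulmxV.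
  by rewrite exprS IH T_eq exprS -mulmxE !mulmxA mulmxKV.
have -> : \tr (A ^+ N) = \tr (T ^+ N).
  by rewrite AN mxtrace_mulC mulmxA mulVmx ?mul1mx.
have [_ Td] := trigmx_expr N T_trig.
rewrite /mxtrace; apply: le_trans (ler_norm_sum _ _ _) _.
rewrite -[leRHS]mulr1 -[n in leRHS]card_ord mulr_natl -sumr_const.
by apply: ler_sum => i _; rewrite Td normrX exprn_ile1.
Qed.

Section NonnegativeMatrix.
Context {K : numDomainType} {n : nat} (A : 'M[K]_n).
Context (A_ge0 : forall i j, 0 <= A i j).

Lemma expr_mx_ge0 N i j : 0 <= (A ^+ N) i j.
Proof.
elim: N i j => [|N IH] i j; first by rewrite expr0 mxE ler0n.
by rewrite exprS mxE sumr_ge0// => k _; rewrite mulr_ge0.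
Qed.

(** The product of the diagonal entries of two powers is one summand of the diagonal entry of their
    product, and the other summands are nonnegative. *)
Lemma expr_mx_diag_ge N k i (c : K) :
  0 <= c -> c <= (A ^+ N) i i -> c ^+ k <= (A ^+ (N * k)) i i.
Proof.
move=> c0 cA; elim: k => [|k IH]; first by rewrite muln0 !expr0 mxE eqxx.
rewrite mulnS exprD exprS mxE (bigD1 i)//= ler_wpDr//.
  by apply: sumr_ge0 => l _; rewrite mulr_ge0// expr_mx_ge0.
by apply: ler_pM => //; exact: exprn_ge0.
Qed.

End NonnegativeMatrix.

(* The trace of [A ^+ (N * k)] is at most [n] by the bound on the eigenvalues,
   and at least [2 ^ k] by the diagonal entry; take [k = n]. *)
Lemma expr_mx_diag_lt2 (C : numClosedFieldType) (n : nat) (A : 'M[C]_n) N i :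
  (forall i j, 0 <= A i j) -> (forall a, eigenvalue A a -> `|a| <= 1) ->
  2 <= (A ^+ N) i i -> False.
Proof.
move=> A0 A1 h.
have := norm_mxtrace_expr_le (N * n) A1.
rewrite ger0_norm; last by apply: sumr_ge0 => j _; exact: expr_mx_ge0.
have h2 : 2 ^+ n <= \tr (A ^+ (N * n)).
  rewrite /mxtrace (bigD1 i)//= ler_wpDr//.
    by apply: sumr_ge0 => j _; exact: expr_mx_ge0.
  by apply: expr_mx_diag_ge.
move/(le_trans h2); rewrite -natrX ler_nat leqNgt.
by rewrite ltn_expl.
Qed.

Lemma spectral_radius1_eigenvalue (R : realType) (n : nat) (A : 'M[R[i]]_n) a :
  spectral_radius A = 1 -> eigenvalue A a -> `|a| <= 1.
Proof.
rewrite /spectral_radius; set E := [set _ | _ in _] => E1 Aa.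
(* By default [sup] is 0 on a set without a supremum, so the value 1 guarantees that [E] is bounded
   above. *)
have hE : has_sup E.
  by apply: contrapT => /sup_out; rewrite E1 => /eqP; rewrite oner_eq0.
have : complex.Re `|a| <= 1 by rewrite -E1; apply: sup_upper_bound => //; exists a.
by rewrite lecE normc_def /= eqxx.
Qed.

(** * Lower bounds on matrix powers from walks *)

Section WalkCount.
Context {K : numDomainType} {e : nat} (P : 'I_e -> seq ('I_e * bool)).
Context (A : 'M[K]_e).
Context (A_ge0 : forall i j, 0 <= A i j).
Context (A_ge1 : forall j k, (k < size (P j))%N -> 1 <= A (target P j k).1 j).
Context (A_ge2 : forall j k l, (k < size (P j))%N -> (l < size (P j))%N ->
  k <> l -> (target P j k).1 = (target P j l).1 -> 2 <= A (target P j k).1 j).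

(** Columns are sources and rows are targets, so the last factor of the power carries the first step
    of the walk. *)
Lemma walk_expr_ge1 j u i : walk P j u i -> 1 <= (A ^+ size u) i j.
Proof.
elim: u j => [|k u IH] j /=; first by move=> /eqP ->; rewrite mxE eqxx.
case/andP=> kj wu; rewrite exprSr mxE (bigD1 (target P j k).1)//= ler_wpDr//.
  by apply: sumr_ge0 => l _; rewrite mulr_ge0// expr_mx_ge0.
by rewrite -[1]mulr1; apply: ler_pM => //; [exact: IH | exact: A_ge1].
Qed.

(** Compare first letters. If they agree, the tails differ and induction applies; if they differ but
    have one target, the entry of [A] supplies the 2; if the targets differ, two summands are each
    at least 1. *)
Lemma distinct_walks_expr_ge2 j u v i :
  walk P j u i -> walk P j v i -> size u = size v -> u <> v ->
  2 <= (A ^+ size u) i j.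
Proof.
elim: u v j => [|k u IH] [|l v] j //= /andP[kj wu] /andP[lj wv] [uv_size] uv.
have pos a : 0 <= (A ^+ size u) i a * A a j by rewrite mulr_ge0// expr_mx_ge0.
rewrite exprSr mxE (bigD1 (target P j k).1)//=.
have [kl|kl] := eqVneq k l.
  rewrite ler_wpDr//; first by apply: sumr_ge0.
  rewrite -[2]mulr1; apply: ler_pM => //; last exact: A_ge1.
  rewrite -kl in wv uv; apply: IH wu wv uv_size _ => h; apply: uv.
  by rewrite h.
have [tkl|tkl] := eqVneq (target P j k).1 (target P j l).1.
  rewrite ler_wpDr//; first by apply: sumr_ge0.
  rewrite -[2]mul1r; apply: ler_pM => //; first exact: walk_expr_ge1.
  by apply: A_ge2 kj lj _ tkl; apply/eqP.
rewrite (bigD1 (target P j l).1)/=; last by rewrite eq_sym.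
rewrite addrA ler_wpDr//; first by apply: sumr_ge0.
rewrite -[2]/(1 + 1); apply: lerD; rewrite -[1]mulr1; apply: ler_pM => //.
- exact: walk_expr_ge1.
- exact: A_ge1.
- by rewrite uv_size; exact: walk_expr_ge1.
- exact: A_ge1.
Qed.

End WalkCount.

(** * Finite sets of periods and eventual sets of multiples *)

Lemma finite_set_range_ord (V : set nat) :
  finite_set V -> exists (r : nat) (p : 'I_r -> nat), V = range p.
Proof.
case/finite_seqP => s ->; exists (size s), (tnth (in_tuple s)).
apply/seteqP; split => [n /= ns|_ [i _ <-] /=]; last exact: mem_tnth.
by have /tnthP[i ->] : n \in in_tuple s by []; exists i.
Qed.

(** The finite sets [A j] join [V] in the list [p]; each remaining [j] contributes one [q] and one
    set of factors. *)
Lemma multiples_decomposition (e : nat) (A : 'I_e -> set nat) (V : set nat) :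
  finite_set V -> V `<=` [set n | (0 < n)%N] ->
  (forall j, A j `<=` [set n | (0 < n)%N]) ->
  (forall j, finite_set (A j) \/ exists q B, [/\ (0 < q)%N,
     (forall n, A j n -> (q %| n)%N) &
     forall n, (q %| n)%N -> (B <= n)%N -> A j n]) ->
  exists (r s : nat) (p : 'I_r -> nat) (q : 'I_s -> nat)
         (K : 'I_s -> set nat),
     [/\ (forall i, (0 < p i)%N),
         (forall i, (0 < q i)%N),
         (forall i, K i `<=` [set k | (0 < k)%N]),
         (forall i, finite_set ([set k | (0 < k)%N] `\` K i)) &
         V `|` \bigcup_(j in [set: 'I_e]) A j =
           (\bigcup_(i in [set: 'I_s]) [set (k * q i)%N | k in K i])
           `|` range p].
Proof.
move=> V_fin V0 A0 A_or.
pose D := [set j | finite_set (A j)].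
have [r [p p_eq]] : exists (r : nat) (p : 'I_r -> nat),
    V `|` \bigcup_(j in D) A j = range p.
  apply: finite_set_range_ord; rewrite finite_setU; split => //.
  by apply: bigcup_finite => // ; exact: finite_finset.
(* The choice ranges over all [j], so the members of [D] receive the dummy value 0. *)
have /choice[q qP] : forall j, exists q, ~ D j -> (0 < q)%N /\ exists B,
    (forall n, A j n -> (q %| n)%N) /\
    forall n, (q %| n)%N -> (B <= n)%N -> A j n.
  move=> j; case: (A_or j) => [Dj|[q [B [q0 qA Aq]]]].
    by exists 0%N => /(_ Dj).
  by exists q => _; split => //; exists B.
pose J := [set j | `[< ~ D j >]]%SET.
have JD (i : 'I_#|J|) : ~ D (enum_val i).
  by have := enum_valP i; rewrite inE => /asboolP.
exists r, #|J|, p, (fun i => q (enum_val i)),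
  (fun i => [set k | (0 < k)%N /\ A (enum_val i) (k * q (enum_val i))%N]).
split.
- move=> i; have : (V `|` \bigcup_(j in D) A j) (p i) by rewrite p_eq; exists i.
  by case=> [/V0//|[j _ /A0]].
- by move=> i; have [] := qP _ (JD i).
- by move=> i k [].
- move=> i; have [q0 [B [qA Aq]]] := qP _ (JD i).
  (* As [q] is positive, [k >= B] gives [k * q >= B]; hence every missing factor is below [B]. *)
  apply: (sub_finite_set _ (finite_II B)) => k /= [k0 kK].
  rewrite ltnNge; apply/negP => Bk; apply: kK; split => //.
  apply: Aq; first exact: dvdn_mull.
  by apply: leq_trans Bk _; rewrite leq_pmulr.
apply/seteqP; split.
  move=> n Vn; have [VDn|VDn] := pselect ((V `|` \bigcup_(j in D) A j) n).
    by right; rewrite -p_eq.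
  left; case: Vn => [Vn|[j _ Ajn]]; first by case: VDn; left.
  have Dj : ~ D j by move=> Dj; apply: VDn; right; exists j.
  have Jj : j \in J by rewrite inE; apply/asboolP.
  have [q0 [B [qA _]]] := qP j Dj.
  exists (enum_rank_in Jj j) => //=.
  rewrite enum_rankK_in//; exists (n %/ q j)%N; last by rewrite divnK// qA.
  rewrite divnK ?qA//; split => //; rewrite divn_gt0// dvdn_leq ?qA//.
  exact: A0 Ajn.
move=> n [[i _ [k [k0 Ak] <-]]|pn]; first by right; exists (enum_val i).
have : (V `|` \bigcup_(j in D) A j) n by rewrite p_eq.
by case=> [Vn|[j _ Aj]]; [left | right; exists j].
Qed.

Lemma finite_minimal_periods (T : Type) (f : T -> T) (V : set T) :
  finite_set V -> finite_set [set n | exists2 v, V v & minimal_period f v n].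
Proof.
move=> V_fin.
have uniq_per v n m : minimal_period f v n -> minimal_period f v m -> n = m.
  move=> vn vm; apply/eqP; rewrite eqn_dvd.
  by rewrite (minimal_period_dvdn vn (let: And3 _ h _ := vm in h))
    (minimal_period_dvdn vm (let: And3 _ h _ := vn in h)).
pose per v := xget 0%N [set n | minimal_period f v n].
apply: (sub_finite_set _ (finite_image per V_fin)) => n [v Vv vn].
exists v => //; rewrite /per; case: xgetP => [m _|/(_ n)//].
by move=> /uniq_per; apply.
Qed.

(** * Comparison of the graph map with its lift, and the Markov matrix *)

Lemma within_continuous_comp (X Y Z : topologicalType) (A : set X) (B : set Y)
    (f : X -> Y) (g : Y -> Z) :
  {within A, continuous f} -> {within B, continuous g} ->
  (forall x, A x -> B (f x)) -> {within A, continuous (g \o f)}.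
Proof.
move=> /subspace_continuousP fc /subspace_continuousP gc fAB.
apply/subspace_continuousP => x Ax W /(gc _ (fAB _ Ax)) gW.
have := fc _ Ax _ gW; rewrite /nbhs /= /within /=.
by apply: filterS => y h Ay; exact: h Ay (fAB _ Ay).
Qed.

Lemma continuous_affine (R : realType) (a b : R) :
  continuous ((fun x => a + b * x) : R -> R).
Proof.
move=> x; apply: cvgD; first exact: cvg_cst.
by apply: cvgM; [exact: cvg_cst | exact: cvg_id].
Qed.

Section LinearizedGraph.
Context {R : realType} (G : graph R) (L : G -> G).
Context (P : 'I_(edge_count G) -> seq (oriented_edge G)).
Context (P_gt0 : forall j, (0 < size (P j))%N).
Context (PL : forall j, linear_along (L \o edge j) (P j)).
Implicit Types (i j : 'I_(edge_count G)) (t : R).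

Local Notation F := (lifted_map P).

Lemma edge_inj i t t' :
  0 <= t <= 1 -> 0 <= t' <= 1 -> edge (g := G) i t = edge i t' -> t = t'.
Proof.
move=> t01 t'01 tt'; have [g [_ _ gK _]] := edge_homeomorphism (g := G) i.
have [_ <-] := gK t (ltac:(by rewrite /unit_interval /= in_itv)).
have [_ <-] := gK t' (ltac:(by rewrite /unit_interval /= in_itv)).
by rewrite tt'.
Qed.

(** Distinct edges meet only in vertices, and an interior point is not a vertex. *)
Lemma edge_interior_inj i j t t' :
  0 < t < 1 -> 0 <= t' <= 1 -> edge (g := G) i t = edge j t' ->
  i = j /\ t = t'.
Proof.
move=> t01 t'01 tt'.
have t01' : 0 <= t <= 1 by lra.
have [ij|/eqP ij] := eqVneq i j.
  by split => //; subst j; exact: edge_inj tt'.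
have vt := @edge_interior R G i t t01.
have It : (edge i @` @unit_interval R `&` edge j @` @unit_interval R) (edge i t).
  split; first by exists t => //=; rewrite /unit_interval /= in_itv.
  by rewrite tt'; exists t' => //=; rewrite /unit_interval /= in_itv.
case: (edge_intersection ij) => [I0|[v vv Iv]|[v [w [vv vw _ Ivw]]]].
- by move: It; rewrite I0.
- by move: It; rewrite Iv => tv; case: vt; rewrite tv.
- by move: It; rewrite Ivw => -[] tv; case: vt; rewrite tv.
Qed.

Definition edge_point (z : 'I_(edge_count G) * R) : G := edge z.1 z.2.

(** [edge_point] semiconjugates the lift to [L]. As [linear_along] covers closed pieces, the choice
    made by [piece] at a common end is harmless. *)
Lemma linearization_edge_point z :
  0 <= z.2 <= 1 -> L (edge_point z) = edge_point (F z).
Proof.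
move=> z01; have x01 := piece_itv P_gt0 z01.
have m0 := @size_gt0 R _ _ P_gt0 z.1.
case oE : (onth (P z.1) (piece P z)) => [oe|]; last first.
  have := onthTE (P z.1) (piece P z).
  by rewrite oE /= piece_lt.
have := PL oE x01; rewrite addrC subrK mulrC mulKf ?gt_eqF// /= => ->.
rewrite /oedge /edge_point /lifted_map /flip /target.
by rewrite (onth_nth _ _ _ _ oE).
Qed.

Lemma iter_linearization_edge_point z n :
  0 <= z.2 <= 1 -> iter n L (edge_point z) = edge_point (iter n F z).
Proof.
move=> z01; elim: n => // n IH.
by rewrite iterS IH linearization_edge_point//; exact: iter_lifted_map_itv.
Qed.

(** An interior point comes from a single pair (edge, parameter), so it returns in the graph exactly
    when it returns in the lift. *)
Lemma minimal_period_edge_point j t n : 0 < t < 1 ->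
  minimal_period L (edge j t) n <-> minimal_period F (j, t) n.
Proof.
move=> t01; have t01' : 0 <= t <= 1 by lra.
have per k : iter k L (edge j t) = edge j t <-> iter k F (j, t) = (j, t).
  rewrite -[edge j t]/(edge_point (j, t)) iter_linearization_edge_point//.
  split => [/esym h|-> //].
  have [] := edge_interior_inj t01 _ h; first exact: iter_lifted_map_itv.
  by move=> hj ht; rewrite [LHS]surjective_pairing -hj -ht.
by split=> -[n0 /per Ln min_n]; split => // k kn /per; exact: min_n.
Qed.

Definition interior_periods j : set nat :=
  [set n | exists2 t : R, 0 < t < 1 & minimal_period F (j, t) n].

Lemma periods_linearization :
  periods L =
  [set n | exists2 v, vertices G v & minimal_period L v n] `|`
  \bigcup_(j in [set: 'I_(edge_count G)]) interior_periods j.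
Proof.
apply/seteqP; split => [n [x xn]|n [[v _ vn]|[j _ [t t01 tn]]]]; last 2 first.
- by exists v.
- by exists (edge j t); apply/minimal_period_edge_point.
have : [set: G] x by [].
rewrite space_cover => -[vx|[j _ [t + tx]]]; first by left; exists x.
rewrite /unit_interval /= in_itv /= => t01.
have [v0 v1 _] := edge_boundary (g := G) j.
have [t0|t0] := eqVneq t 0.
  by left; exists x => //; rewrite -tx t0.
have [t1|t1] := eqVneq t 1.
  by left; exists x => //; rewrite -tx t1.
have t01' : 0 < t < 1 by rewrite !lt_neqAle eq_sym t0 t1.
right; exists j => //; exists t => //.
by apply/minimal_period_edge_point; rewrite ?tx.
Qed.

(** The interior of each piece is sent into the interior of an edge, away from the vertices. *)
Lemma linearization_vertex_grid j a : 0 <= a <= 1 ->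
  vertices G (L (edge j a)) ->
  exists2 k : nat, (k <= size (P j))%N & a = k%:R / (size (P j))%:R.
Proof.
move=> a01; rewrite -[edge j a]/(edge_point (j, a)) linearization_edge_point//.
have m0 := @size_gt0 R _ _ P_gt0 j.
have x01 := piece_itv P_gt0 (z := (j, a)) a01.
have km := piece_lt P_gt0 (j, a).
move: x01 km; rewrite /edge_point /lifted_map /=.
set k := piece P (j, a); set x := _ - _ => x01 km hv.
have [x0|x0] := eqVneq x 0.
  exists k; first exact: ltnW.
  by rewrite -(subr0_eq x0) mulrC mulKf ?gt_eqF.
have [x1|x1] := eqVneq x 1.
  exists k.+1 => //.
  have -> : k.+1%:R = (size (P j))%:R * a by move: x1; rewrite -natr1 /x; lra.
  by rewrite mulrC mulKf ?gt_eqF.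
case: (@edge_interior _ G _ _ _ hv).
by apply: flip_itvoo; rewrite !lt_neqAle eq_sym x0 x1.
Qed.

(** Read in the coordinate of the edge [i], [f] is a continuous injection of [a, b] onto [0, 1]. It
    is therefore strictly monotone and sends ends to ends. *)
Lemma segment_homeomorphism_ends (a b : R) (f : R -> G) i : a < b ->
  homeomorphism_on (`[a, b]%classic : set R) (edge_set i) f ->
  vertices G (f a) /\ vertices G (f b).
Proof.
move=> ab [f' [fc _ f'K fK]].
have [g [_ gc gK Kg]] := edge_homeomorphism (g := G) i.
pose h := g \o f.
have I01 x : `[a, b]%classic x = (x \in `[a, b]) by [].
have hc : {within `[a, b], continuous h}.
  by apply: within_continuous_comp fc gc _ => x /f'K[].
have h_inj : {in `[a, b] &, injective h}.
  move=> x y xab yab /= hxy.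
  have [fx <-] := f'K x xab; have [fy <-] := f'K y yab.
  by have [_ <-] := Kg _ fx; have [_ <-] := Kg _ fy; rewrite [g _]hxy.
have h01 x : x \in `[a, b] -> 0 <= h x <= 1.
  by move=> /f'K[/Kg[+ _] _]; rewrite /unit_interval /= in_itv.
have h_surj t : 0 <= t <= 1 -> exists2 x, x \in `[a, b] & h x = t.
  move=> t01; have ti : unit_interval t by rewrite /unit_interval /= in_itv.
  have [fi gi] := gK t ti; have [f'i ff'] := fK _ fi.
  by exists (f' (edge i t)) => //; rewrite /h /= ff'.
have aI : a \in `[a, b] by rewrite in_itv /= lexx ltW.
have bI : b \in `[a, b] by rewrite in_itv /= lexx ltW.
have [v0 v1 _] := edge_boundary (g := G) i.
have end_v x : x \in `[a, b] -> h x = 0 \/ h x = 1 -> vertices G (f x).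
  move=> xab hx; have [fx _] := f'K x xab; have [_ <-] := Kg _ fx.
  by case: hx; rewrite /h /= => ->.
have [x0 x0I hx0] := h_surj 0 (ltac:(by rewrite lexx ler01)).
have [x1 x1I hx1] := h_surj 1 (ltac:(by rewrite lexx ler01)).
have := x0I; have := x1I; rewrite !in_itv /= => /andP[ax1 x1b] /andP[ax0 x0b].
have := h01 _ aI; have := h01 _ bI => hb ha.
case: (itv_continuous_inj_mono hc h_inj) => h_mono.
  have h_le x y : x \in `[a, b] -> y \in `[a, b] -> x <= y -> h x <= h y.
    move=> xI yI; rewrite le_eqVlt => /orP[/eqP->//|xy].
    by apply/ltW/h_mono.
  have := h_le _ _ aI x0I ax0; have := h_le _ _ x1I bI x1b.
  by rewrite hx0 hx1 => hb' ha'; split; apply: end_v => //; lra.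
have h_ge x y : x \in `[a, b] -> y \in `[a, b] -> x <= y -> h y <= h x.
  move=> xI yI; rewrite le_eqVlt => /orP[/eqP->//|xy].
  by apply/ltW/h_mono.
have := h_ge _ _ aI x1I ax1; have := h_ge _ _ x0I bI x0b.
by rewrite hx0 hx1 => hb' ha'; split; apply: end_v => //; lra.
Qed.

(** Both ends of such a subinterval are sent to vertices, hence lie on a finite grid. This makes the
    cardinals in [markov_matrix] genuine counts. *)
Lemma covering_subintervals_finite i j :
  finite_set (covering_subintervals L i j).
Proof.
pose m := size (P j); pose I := [set k : nat | (k < m.+1)%N].
have fin : finite_set (I `*` I) by apply: finite_setX; exact: finite_II.
apply: (sub_finite_set _ (finite_image
  (fun kl : nat * nat => (kl.1%:R / m%:R, kl.2%:R / m%:R) : R * R) fin)).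
move=> [a b] [/= a0 ab b1 /(segment_homeomorphism_ends ab)[va vb]].
have [k km ->] := linearization_vertex_grid (ltac:(lra) : 0 <= a <= 1) va.
have [l lm ->] := linearization_vertex_grid (ltac:(lra) : 0 <= b <= 1) vb.
by exists (k, l).
Qed.

Lemma covering_subintervals_piece j k : (k < size (P j))%N ->
  covering_subintervals L (target P j k).1 j
    (k%:R / (size (P j))%:R, k.+1%:R / (size (P j))%:R).
Proof.
move=> km; set o := target P j k; set m := size (P j).
have m0 : 0 < m%:R :> R := @size_gt0 R _ _ P_gt0 j.
have k0 : 0 <= k%:R :> R by [].
have km' : k.+1%:R <= m%:R :> R by rewrite ler_nat.
have mE x : m%:R * x / m%:R = x :> R by field; lra.
split => /=.
- by rewrite divr_ge0// ltW.
- by rewrite ltr_pM2r ?invr_gt0// ltr_nat.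
- by rewrite ler_pdivrMr// mul1r.
have seg (x : R) : `[k%:R / m%:R, k.+1%:R / m%:R]%classic x <->
    0 <= m%:R * x - k%:R <= 1.
  rewrite /= in_itv /= ler_pdivrMr// ler_pdivlMr// -natr1 [x * _]mulrC.
  by split; lra.
have Lx x : `[k%:R / m%:R, k.+1%:R / m%:R]%classic x ->
    L (edge j x) = edge o.1 (flip o.2 (m%:R * x - k%:R)).
  move=> /seg x01; case oE : (onth (P j) k) => [oe|]; last first.
    by have := onthTE (P j) k; rewrite oE /= km.
  have := PL oE x01; rewrite addrC subrK mulrC mulKf ?gt_eqF// /= => ->.
  by rewrite /o /target (onth_nth _ _ _ _ oE).
have [g [ec gc gK Kg]] := edge_homeomorphism (g := G) o.1.
have flip_affine : exists c d : R, forall t, flip o.2 t = c + d * t.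
  rewrite /flip; case: o.2; first by exists 0, 1 => t; lra.
  by exists 1, (-1) => t; lra.
have [c [d flipE]] := flip_affine.
have ui t : unit_interval t <-> 0 <= t <= 1 :> Prop.
  by rewrite /unit_interval /= in_itv.
(* The inverse reads the coordinate on the target edge, undoes the orientation ([flip] is an
   involution) and rescales to the [k]-th piece. *)
exists (fun y => (k%:R + flip o.2 (g y)) / m%:R); split.
- pose e' := edge o.1 \o (fun x => (c - d * k%:R) + (d * m%:R) * x).
  have eE x : edge o.1 (flip o.2 (m%:R * x - k%:R)) = e' x.
    by rewrite /e' /= flipE; congr edge; ring.
  apply: (@subspace_eq_continuous _ _ _ e').
    move=> x; rewrite inE => xI; apply: etrans (esym (eE x)) _.
    exact: esym (Lx x xI).
  apply: (within_continuous_comp (B := @unit_interval R) _ ec).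
    exact/continuous_subspaceT/continuous_affine.
  move=> x /seg/(flip_itvcc o.2); rewrite flipE => h; apply/ui.
  by rewrite (_ : _ + _ = c + d * (m%:R * x - k%:R)); [|ring].
- pose g' := (fun t => (k%:R + c) / m%:R + (d / m%:R) * t) \o g.
  rewrite (_ : (fun y => _) = g').
    apply: (within_continuous_comp (B := setT) gc) => //.
    exact/continuous_subspaceT/continuous_affine.
  by apply/funext => y; rewrite /g' /= flipE; field; lra.
- move=> x xI; have /seg x01 := xI; rewrite /= Lx//.
  have h := flip_itvcc o.2 x01.
  split; first by exists (flip o.2 (m%:R * x - k%:R)) => //; apply/ui.
  have [_ ->] := gK _ ((ui _).2 h).
  by rewrite flipK addrC subrK mulrC mulKf ?gt_eqF.
- move=> y /Kg[/ui gy ey].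
  have m_y : m%:R * ((k%:R + flip o.2 (g y)) / m%:R) - k%:R = flip o.2 (g y).
    by field; lra.
  have yI : `[k%:R / m%:R, k.+1%:R / m%:R]%classic
      ((k%:R + flip o.2 (g y)) / m%:R).
    by apply/seg; rewrite m_y flip_itvcc.
  by split => //=; rewrite Lx// m_y flipK.
Qed.

Lemma markov_matrix_ge1 j k : (k < size (P j))%N ->
  (1 <= markov_matrix L (target P j k).1 j)%N.
Proof.
move=> km; rewrite mxE cardfs_gt0; apply/negP => /eqP h.
have := covering_subintervals_piece km.
rewrite -[covering_subintervals _ _ _]fset_setK ?h ?set_fset0//.
exact: covering_subintervals_finite.
Qed.

Lemma markov_matrix_ge2 j k l : (k < size (P j))%N -> (l < size (P j))%N ->
  k <> l -> (target P j k).1 = (target P j l).1 ->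
  (2 <= markov_matrix L (target P j k).1 j)%N.
Proof.
move=> km lm kl tkl; rewrite mxE.
have m0 := @size_gt0 R _ _ P_gt0 j.
have hk := covering_subintervals_piece km.
have hl := covering_subintervals_piece lm; rewrite -tkl in hl.
set ck := (_, _) in hk; set cl := (_, _) in hl.
have ckl : ck != cl.
  apply/eqP => -[+ _] => /(mulIf _) => /(_ (ltac:(by rewrite invr_eq0 gt_eqF))).
  by move/eqP; rewrite eqr_nat => /eqP.
have -> : 2%N = #|` [fset ck; cl]%fset| by rewrite cardfs2 ckl.
apply: fsubset_leq_card; apply/fsubsetP => z.
rewrite !inE => /orP[]/eqP ->; rewrite in_fset_set ?inE//;
  exact: covering_subintervals_finite.
Qed.

End LinearizedGraph.

Theorem theorem5 (R : realType) (G : graph R) (f L : G -> G)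
    (hf : vertex_map f) (hL : is_linearization f L) :
  (exists (r s : nat) (p : 'I_r -> nat) (q : 'I_s -> nat)
          (K : 'I_s -> set nat),
     [/\ (forall i, (0 < p i)%N),
         (forall i, (0 < q i)%N),
         (forall i, K i `<=` [set k | (0 < k)%N]),
         (forall i, finite_set ([set k | (0 < k)%N] `\` K i)) &
         periods L =
           (\bigcup_(i in [set: 'I_s]) [set (k * q i)%N | k in K i])
           `|` range p]) /\
  (spectral_radius (map_mx (fun m : nat => m%:R : R[i]) (markov_matrix L)) = 1 ->
   exists (r : nat) (p : 'I_r -> nat),
     (forall i, (0 < p i)%N) /\ periods L = range p).
Proof.
have [fL edgeP] := hL.
have [P PP] := choice edgeP.
have PL j : linear_along (L \o edge j) (P j) by have [] := PP j.
have P_gt0 j : (0 < size (P j))%N.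
  have [pj _ _ _] := PP j; case: (P j) pj => //= f01.
  have [v0 v1] := edge_boundary (g := G) j; case.
  by have [_ [_ finj _]] := hf; apply: finj f01; rewrite inE.
pose A := interior_periods P.
pose V := [set n | exists2 v, vertices G v & minimal_period L v n].
have V_fin : finite_set V := finite_minimal_periods L (@vertices_finite _ G).
have perE : periods L = V `|` \bigcup_(j in setT) A j.
  exact: periods_linearization P_gt0 PL.
have V0 : V `<=` [set n | (0 < n)%N] by move=> n [v _ []].
have A0 j : A j `<=` [set n | (0 < n)%N] by move=> n [t _ []].
pose branching j := exists u v,
  [/\ walk P j u j, walk P j v j, size u = size v & u <> v].
have A_fin j : ~ branching j -> finite_set (A j).
  move=> nb; have uniq_loop u v : walk P j u j -> walk P j v j ->
      size u = size v -> u = v.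
    by move=> wu wv uv; apply: contrapT => uv'; apply: nb; exists u, v.
  (* One nonempty closed walk bounds all interior periods at [j]. If there is none, there are no
     such periods, since the itinerary of a periodic point would be one. *)
  have [[u wu u0]|nu] := pselect (exists2 u, walk P j u j & (0 < size u)%N).
    apply: (sub_finite_set _ (finite_II (2 * size u).+1)) => n [t _ tn].
    by rewrite /= ltnS; have := unique_loops_period P_gt0 uniq_loop wu u0 tn.
  suff -> : A j = set0 by [].
  apply/seteqP; split => // n [t _ [n0 tn _]]; apply: nu.
  exists (itinerary P (j, t) n); last by rewrite size_itinerary.
  by have := walk_itinerary P_gt0 (j, t) n; rewrite tn.
split.
  rewrite perE; apply: multiples_decomposition => // j.
  have [[u [v [wu wv uv_size uv]]]|/A_fin ?] := pselect (branching j); last by left.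
  have [q [B [q0 qA Aq]]] := distinct_loops_periods (R := R) P_gt0 wu wv uv uv_size.
  by right; exists q, B; split => // n [t _ [_ tn _]]; exact: qA tn.
move=> rho1.
have nb j : ~ branching j.
  move=> [u [v [wu wv uv_size uv]]].
  set M := map_mx _ _ in rho1.
  apply: (@expr_mx_diag_lt2 _ _ M (size u) j).
  - by move=> i k; rewrite mxE ler0n.
  - by move=> a; exact: spectral_radius1_eigenvalue.
  apply: distinct_walks_expr_ge2 wu wv uv_size uv.
  - by move=> i k; rewrite mxE ler0n.
  - by move=> i k kP; rewrite mxE ler1n; exact: markov_matrix_ge1.
  - move=> i k l kP lP kl tkl; rewrite mxE ler_nat.
    exact: markov_matrix_ge2 kP lP kl tkl.
have [r [p p_eq]] : exists (r : nat) (p : 'I_r -> nat), periods L = range p.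
  apply: finite_set_range_ord; rewrite perE finite_setU; split => //.
  by apply: bigcup_finite => [|j _]; [exact: finite_finset | exact: A_fin].
exists r, p; split => // i.
have : periods L (p i) by rewrite p_eq; exists i.
by case=> x [].
Qed.
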